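(* (Explicit Rayleigh's Monotonicity Law I.) Let $\Gamma$ be a metrized graph and let $e_i$ be an edge of $\Gamma$ with end points $p_i,q_i$ and length $L_i$. If $e_i$ is not a bridge of $\Gamma$, then for any $s,t\in\Gamma-e_i$, $$r(s,t)=r_{\overline{\Gamma}_i}(s,t)+\frac{L_i+R_i}{L_iR_i}\big[j_{p_i}(q_i,s)-j_{p_i}(q_i,t)\big]^2=r_{\overline{\Gamma}_i}(s,t)+\frac{L_i}{R_i(L_i+R_i)}\big[j^{\Gamma-e_i}_{p_i}(q_i,s)-j^{\Gamma-e_i}_{p_i}(q_i,t)\big]^2.$$ In particular $r(s,t)\ge r_{\overline{\Gamma}_i}(s,t)$, with equality if and only if $j_{p_i}(q_i,s)=j_{p_i}(q_i,t)$. If $e_i$ is a bridge of $\Gamma$, then for $s,t\in\Gamma-e_i$: $r(s,t)=r_{\overline{\Gamma}_i}(s,t)$ when $s$ and $t$ lie in the same connected component of $\Gamma-e_i$, and $r(s,t)=r_{\overline{\Gamma}_i}(s,t)+L_i$ otherwise.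
   Context: A metrized graph $\Gamma$ is a finite connected graph (multiple edges and self-loops allowed) in which each edge is identified with a closed line segment of positive length. $\Gamma$ is regarded as a resistive electric circuit in which each edge is a resistor whose resistance equals its length. $r(x,y)$ is the effective resistance between $x$ and $y$; $j_z(x,y)$ is the voltage at $x$ when a unit current enters at $y$ and exits at $z$, with reference voltage $0$ at $z$. $\Gamma-e_i$ is obtained from $\Gamma$ by deleting the interior of $e_i$; $e_i$ is a bridge if $\Gamma-e_i$ is disconnected; for a non-bridge $e_i$, $R_i:=r_{\Gamma-e_i}(p_i,q_i)$. $\overline{\Gamma}_i$ is the metrized graph obtained from $\Gamma$ by contracting the edge $e_i$ to a point (so $p_i=q_i$ in $\overline{\Gamma}_i$). Subscripts/superscripts indicate the graph on which resistance/voltage functions are computed. *)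

(* Defs.v *)
From HB Require Import structures.
From mathcomp Require Import all_boot all_order all_algebra.
From mathcomp Require Import reals.
From Stdlib Require Import ClassicalEpsilon Relations.
Set Implicit Arguments. Unset Strict Implicit. Unset Printing Implicit Defensive.
Import Order.TTheory GRing.Theory Num.Theory.
Local Open Scope ring_scope.

(* A model of a metrized graph: vertices 0 .. nv-1, and a list of edges
   ((p, q), L): an edge with end points p, q (self-loops and multiple edges
   allowed) identified with a segment of length L.  Edge number k is
   parametrized by the distance x (0 < x < L) from its first end point p. *)
Record mgraph (R : Type) := MGraph { nv : nat; edges : seq ((nat * nat) * R) }.

Section MetrizedGraphs.
Variable R : realType.
Implicit Types (G : mgraph R) (e : (nat * nat) * R).

Definition ep1 e : nat := e.1.1.
Definition ep2 e : nat := e.1.2.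
Definition elen e : R := e.2.
Definition edge0 : (nat * nat) * R := ((0%N, 0%N), 0).
Definition edge_of G (k : nat) := nth edge0 (edges G) k.

(* adjacency and connectedness (of the vertex set; every point lies on an
   edge whose end points are vertices) *)
Definition adj G (u v : nat) : bool :=
  has (fun e => ((ep1 e == u) && (ep2 e == v)) || ((ep1 e == v) && (ep2 e == u)))
      (edges G).
Definition reach G := clos_refl_trans nat (fun a b => adj G a b).
Definition connected G : Prop :=
  forall u v, (u < nv G)%N -> (v < nv G)%N -> reach G u v.

Definition metrized_graph G : Prop :=
  (0 < nv G)%N /\
  (forall e, e \in edges G -> [/\ (ep1 e < nv G)%N, (ep2 e < nv G)%N & 0 < elen e]) /\
  connected G.

Definition outflow G (phi : nat -> R) (v : nat) : R :=
  \sum_(e <- edges G)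
     ((if ep1 e == v then (phi v - phi (ep2 e)) / elen e else 0) +
      (if ep2 e == v then (phi v - phi (ep1 e)) / elen e else 0)).

Definition is_voltage G (y z : nat) (phi : nat -> R) : Prop :=
  (forall v, (v < nv G)%N ->
     outflow G phi v = (v == y)%:R - (v == z)%:R) /\ phi z = 0.

Definition voltage G (y z : nat) : nat -> R :=
  epsilon (inhabits (fun _ : nat => 0 : R)) (is_voltage G y z).

Definition jv G (z x y : nat) : R := voltage G y z x.

Inductive point := Vtx of nat | EdgePt of nat & R.

Definition valid_point G (P : point) : bool :=
  match P with
  | Vtx v => (v < nv G)%N
  | EdgePt k x => (k < size (edges G))%N && (0 < x < elen (edge_of G k))
  end.

Definition subdiv G (k : nat) (x : R) : mgraph R :=
  let e := edge_of G k in
  MGraph (nv G).+1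
    (set_nth edge0 (edges G) k ((ep1 e, nv G), x) ++
     [:: ((nv G, ep2 e), elen e - x)]).

(* the same point of the metrized graph, described in subdiv G k x *)
Definition lift_point G (k : nat) (x : R) (P : point) : point :=
  match P with
  | Vtx v => Vtx v
  | EdgePt k' x' =>
      if k' != k then EdgePt k' x'
      else if x' < x then EdgePt k x'
      else if x' == x then Vtx (nv G)
      else EdgePt (size (edges G)) (x' - x)
  end.

Definition vertexify G (P : point) : mgraph R * nat :=
  match P with
  | Vtx v => (G, v)
  | EdgePt k x => (subdiv G k x, nv G)
  end.

Definition transport G (P Q : point) : point :=
  match P with
  | Vtx _ => Q
  | EdgePt k x => lift_point G k x Q
  end.

(* subdivide successively so that all listed points become vertices;
   [f] maps the original description of a point to its description in the
   current (subdivided) graph G *)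
Fixpoint vertexify_aux G (f : point -> point) (ps : seq point)
  : mgraph R * seq nat :=
  match ps with
  | [::] => (G, [::])
  | P0 :: ps' =>
      let P := f P0 in
      let G1 := (vertexify G P).1 in
      let v := (vertexify G P).2 in
      let res := vertexify_aux G1 (fun Q => transport G P (f Q)) ps' in
      (res.1, v :: res.2)
  end.

Definition vertexify_seq G (ps : seq point) : mgraph R * seq nat :=
  vertexify_aux G id ps.

(* j_z(x,y) for arbitrary points: voltage at x when a unit current enters
   at y and exits at z, reference voltage 0 at z *)
Definition jfun G (z x y : point) : R :=
  let res := vertexify_seq G [:: z; x; y] in
  jv res.1 (nth 0%N res.2 0) (nth 0%N res.2 1) (nth 0%N res.2 2).

Definition resistance G (x y : point) : R := jfun G y x x.

Definition delete_edge G (k : nat) : mgraph R :=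
  MGraph (nv G) (take k (edges G) ++ drop k.+1 (edges G)).

(* a point of Gamma - e_k (not interior to e_k), described in delete_edge G k *)
Definition del_point (k : nat) (P : point) : point :=
  match P with
  | Vtx v => Vtx v
  | EdgePt k' x => if (k' < k)%N then EdgePt k' x else EdgePt k'.-1 x
  end.

Definition is_bridge G (k : nat) : Prop := ~ connected (delete_edge G k).

Definition in_minus G (k : nat) (P : point) : bool :=
  valid_point G P &&
  match P with EdgePt k' _ => k' != k | Vtx _ => true end.

Definition relabel (a b v : nat) : nat :=
  let v' := if v == b then a else v in if (b < v')%N then v'.-1 else v'.

Definition contract G (k : nat) : mgraph R :=
  let e := edge_of G k in
  let a := ep1 e in let b := ep2 e in
  if a == b then delete_edge G k
  else MGraph (nv G).-1
         [seq ((relabel a b (ep1 f), relabel a b (ep2 f)), elen f)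
         | f <- edges (delete_edge G k)].

Definition contract_point G (k : nat) (P : point) : point :=
  let e := edge_of G k in
  let a := ep1 e in let b := ep2 e in
  match del_point k P with
  | Vtx v => if a == b then Vtx v else Vtx (relabel a b v)
  | EdgePt k' x => EdgePt k' x
  end.

Definition anchor G (P : point) : nat :=
  match P with Vtx v => v | EdgePt k _ => ep1 (edge_of G k) end.

Definition same_component G (P Q : point) : Prop :=
  reach G (anchor G P) (anchor G Q).

End MetrizedGraphs.

(* Main.v *)
(* Let H be the graph with e_i removed, D := psi s - psi t where psi is the
   voltage on H of a unit current from q_i to p_i, and u the voltage on H of a
   unit current from s to t; by reciprocity u q_i - u p_i = D.  Every voltage
   from s to t on Gamma or on the contraction is u + c psi up to a constant:
   Ohm's law on e_i forces c = - D / (L_i + R_i) on Gamma, and equal potentials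
   at p_i and q_i force c = - D / R_i on the contraction.  Hence the two
   resistances are r_H(s, t) - D^2 / (L_i + R_i) and r_H(s, t) - D^2 / R_i.
   For a bridge, the role of psi is played by the indicator function of the
   component of q_i in H, which has zero Dirichlet energy on H.

   Interior points are handled by affine extension of potentials to a
   subdivision: this preserves the Dirichlet form, and subdividing at points
   off e_i commutes with deleting and with contracting e_i. *)

Require Import Defs.
From HB Require Import structures.
From mathcomp Require Import all_boot all_order all_algebra.
From mathcomp Require Import reals.
From mathcomp Require Import ring lra zify.
From Stdlib Require Import Classical ClassicalEpsilon Relations.
Import Order.TTheory GRing.Theory Num.Theory.
Local Open Scope ring_scope.

Section Resistance.
Local Set Implicit Arguments.
Local Unset Strict Implicit.
Variable R : realType.
Implicit Types (G : mgraph R) (e : (nat * nat) * R) (f g phi : nat -> R).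
Implicit Types (P Q : point R).

(** * The Dirichlet form and solvability of the weak Kirchhoff law *)

Definition well_formed G : Prop :=
  forall e, e \in edges G -> [/\ (ep1 e < nv G)%N, (ep2 e < nv G)%N & 0 < elen e].

(** Connectedness in functional form: only constants have zero energy. It passes to subdivisions and
    contractions by moving functions, without building paths. *)
Definition rigid G : Prop :=
  forall f, (forall e, e \in edges G -> f (ep1 e) = f (ep2 e)) ->
  forall u v, (u < nv G)%N -> (v < nv G)%N -> f u = f v.

Definition dirichlet f g e : R :=
  (f (ep1 e) - f (ep2 e)) * (g (ep1 e) - g (ep2 e)) / elen e.

Definition energy G f g : R := \sum_(e <- edges G) dirichlet f g e.

(* The weak form of Kirchhoff's law for a unit current entering at y and
   leaving at z. *)
Definition unit_flow G (y z : nat) phi : Prop :=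
  forall g, energy G phi g = g y - g z.

Lemma connected_rigid G : connected G -> rigid G.
Proof.
move=> cG f fE u v hu hv; elim: (cG _ _ hu hv) => // [a b|a b c _ -> _ -> //].
case/hasP=> e he /orP[] /andP[/eqP <- /eqP <-]; first exact: fE.
by rewrite fE.
Qed.

Lemma energyC G f g : energy G f g = energy G g f.
Proof. by apply: eq_bigr => e _; rewrite /dirichlet (mulrC (f _ - _)). Qed.

Lemma energy_ext G f f' g g' : well_formed G ->
  (forall v, (v < nv G)%N -> f v = f' v) -> (forall v, (v < nv G)%N -> g v = g' v) ->
  energy G f g = energy G f' g'.
Proof.
move=> wG Ef Eg; apply: eq_big_seq => e /wG[h1 h2 _].
by rewrite /dirichlet !Ef // !Eg.
Qed.

Lemma energy_linear G c f f' g :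
  energy G (fun v => f v + c * f' v) g = energy G f g + c * energy G f' g.
Proof.
rewrite /energy mulr_sumr -big_split; apply: eq_bigr => e _ /=.
by rewrite /dirichlet; ring.
Qed.

Lemma energy_sum G (I : finType) (c : I -> R) (h : I -> nat -> R) g :
  energy G (fun v => \sum_i c i * h i v) g = \sum_i c i * energy G (h i) g.
Proof.
under [RHS]eq_bigr => i _ do rewrite /energy mulr_sumr.
rewrite exchange_big /=; apply: eq_bigr => e _.
rewrite /dirichlet -sumrB !mulr_suml; apply: eq_bigr => i _; ring.
Qed.

Lemma energy_ge0 G f : well_formed G -> 0 <= energy G f f.
Proof.
move=> wG; rewrite /energy big_seq sumr_ge0 // => e /wG[_ _ L0].
by rewrite /dirichlet -expr2 mulr_ge0 ?sqr_ge0 ?invr_ge0 ?ltW.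
Qed.

Lemma energy_eq0 G f : well_formed G -> energy G f f = 0 ->
  forall e, e \in edges G -> f (ep1 e) = f (ep2 e).
Proof.
move=> wG /eqP; rewrite /energy big_seq psumr_eq0; last first.
  move=> e /wG[_ _ L0].
  by rewrite /dirichlet -expr2 mulr_ge0 ?sqr_ge0 ?invr_ge0 ?ltW.
move=> /allP h e he; have /= := h e he; rewrite he /= /dirichlet.
have [_ _ L0] := wG e he.
by rewrite !mulf_eq0 orbb invr_eq0 (gt_eqF L0) orbF subr_eq0 => /eqP.
Qed.

Definition delta (i v : nat) : R := (v == i)%:R.

Lemma sum_delta (n : nat) g v : (v < n)%N -> \sum_(i < n) g i * delta i v = g v.
Proof.
move=> hv; rewrite (bigD1 (Ordinal hv)) //= /delta eqxx mulr1 big1 ?addr0 //.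
by move=> i /eqP ne; case: eqP => [E|]; rewrite ?mulr0 //; case: ne; apply: val_inj.
Qed.

Lemma energy_delta_sum G f g : well_formed G ->
  energy G f g = \sum_(i < nv G) g i * energy G f (delta i).
Proof.
move=> wG; rewrite -(@energy_ext G f f (fun v => \sum_(i < nv G) g i * delta i v)) //.
  by rewrite energyC energy_sum; apply: eq_bigr => i _; rewrite energyC.
exact: sum_delta.
Qed.

(** Testing against [delta v] keeps the edges at [v], signed by the end they have there; a self-loop
    contributes zero on both sides. *)
Lemma outflow_energy G phi v : outflow G phi v = energy G phi (delta v).
Proof.
apply: eq_bigr => e _; rewrite /dirichlet /delta.
case: eqP => [->|_]; case: eqP => [->|_] /=; rewrite /elen; ring.
Qed.

(* The form E(f, g) + f z * g z is positive definite on a rigid graph; testing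
   the solution against the constant 1 shows that it vanishes at z. *)
Lemma unit_flow_exists G y z : well_formed G -> rigid G ->
  (y < nv G)%N -> (z < nv G)%N -> exists2 phi, unit_flow G y z phi & phi z = 0.
Proof.
move=> wG rG hy hz; set n := nv G.
pose A : 'M[R]_n := \matrix_(i, j) (energy G (delta i) (delta j) + delta i z * delta j z).
pose F (w : 'rV[R]_n) (v : nat) : R := \sum_i w 0 i * delta i v.
have FA w (g : nat -> R) : energy G (F w) g + F w z * g z = \sum_(j < n) g j * (w *m A) 0 j.
  rewrite energy_delta_sum // -[g z](@sum_delta n) // mulr_sumr -big_split /=.
  apply: eq_bigr => j _; rewrite /F energy_sum mxE mulrCA -mulrDr; congr (_ * _).
  rewrite mulr_suml -big_split /=; apply: eq_bigr => i _; rewrite mxE; ring.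
have uA : A \in unitmx.
  (* A left kernel vector gives a potential of zero energy that vanishes at [z], hence the zero
     potential by rigidity. *)
  rewrite unitmxE unitfE; apply/negP => /det0P[w w0 wA].
  have E0 : energy G (F w) (F w) + F w z * F w z = 0.
    by rewrite FA wA big1 // => j _; rewrite mxE mulr0.
  have Eg := energy_ge0 (F w) wG.
  have z2 : 0 <= F w z * F w z by rewrite -expr2 sqr_ge0.
  have Fz : F w z = 0 by apply/eqP; rewrite -[_ == 0]orbb -mulf_eq0; apply/eqP; lra.
  have /energy_eq0 : energy G (F w) (F w) = 0 by lra.
  move=> /(_ wG) /rG cF; case/eqP: w0; apply/rowP => i.
  have := cF i z (ltn_ord i) hz; rewrite Fz /F mxE => <-.
  (* [sum_delta] takes coefficients indexed by naturals, so the row [w] is extended by 0. *)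
  pose w' (k : nat) : R := if insub k is Some j then w 0 j else 0.
  have w'E (j : 'I_n) : w 0 j = w' j by rewrite /w' valK.
  under eq_bigr => j _ do rewrite w'E.
  by rewrite sum_delta // w'E.
pose w := (\row_j (delta j y - delta j z)) *m invmx A.
have Ew g : energy G (F w) g + F w z * g z = g y - g z.
  rewrite FA mulmxKV // -[g y](@sum_delta n) // -[g z](@sum_delta n) //.
  by rewrite -sumrB; apply: eq_bigr => j _; rewrite mxE mulrBr.
have Fz : F w z = 0.
  have := Ew (fun=> 1); rewrite subrr mulr1 /energy big1 ?add0r // => e _.
  by rewrite /dirichlet subrr mulr0 mul0r.
by exists (F w) => // g; rewrite -Ew Fz mul0r addr0.
Qed.

(** * Voltages: existence, uniqueness and reciprocity *)

Lemma voltageP G y z : well_formed G -> rigid G ->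
  (y < nv G)%N -> (z < nv G)%N -> is_voltage G y z (voltage G y z).
Proof.
move=> wG rG hy hz; have [phi phiE phi0] := unit_flow_exists wG rG hy hz.
apply: epsilon_spec; exists phi; split=> // v _.
by rewrite outflow_energy phiE /delta ![_ == v]eq_sym.
Qed.

Lemma voltage_base G y z : well_formed G -> rigid G ->
  (y < nv G)%N -> (z < nv G)%N -> voltage G y z z = 0.
Proof. by move=> wG rG hy hz; have [] := voltageP wG rG hy hz. Qed.

(** Kirchhoff's law at vertex [i] is the weak law tested on [delta i], and these span the test
    functions on the vertices. *)
Lemma voltage_unit_flow G y z : well_formed G -> rigid G ->
  (y < nv G)%N -> (z < nv G)%N -> unit_flow G y z (voltage G y z).
Proof.
move=> wG rG hy hz; have [V _] := voltageP wG rG hy hz.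
move=> g; rewrite energy_delta_sum //.
rewrite -[g y](@sum_delta (nv G)) // -[g z](@sum_delta (nv G)) // -sumrB.
apply: eq_bigr => i _.
by rewrite -outflow_energy V // mulrBr /delta ![_ == i :> nat]eq_sym.
Qed.

(** Uniqueness up to a constant: the difference of two unit flows has zero energy. Any explicit
    potential, normalised or not, thus computes [jv]. *)
Lemma jv_unit_flow G z x y phi : well_formed G -> rigid G ->
  (z < nv G)%N -> (x < nv G)%N -> (y < nv G)%N ->
  unit_flow G y z phi -> jv G z x y = phi x - phi z.
Proof.
move=> wG rG hz hx hy phiE; have VE := voltage_unit_flow wG rG hy hz.
have V0 := voltage_base wG rG hy hz.
pose d v := voltage G y z v + (-1) * phi v.
have /energy_eq0 : energy G d d = 0 by rewrite energy_linear VE phiE; ring.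
move=> /(_ wG)/rG/(_ x z hx hz); rewrite /d V0 /jv => ?; lra.
Qed.

(** Reciprocity: the mutual energy of the two voltages is evaluated in both orders. *)
Lemma jv_sym G z x y : well_formed G -> rigid G ->
  (z < nv G)%N -> (x < nv G)%N -> (y < nv G)%N -> jv G z x y = jv G z y x.
Proof.
move=> wG rG hz hx hy; rewrite /jv.
have := voltage_unit_flow wG rG hy hz (voltage G x z).
rewrite energyC (voltage_unit_flow wG rG hx hz) !voltage_base //; lra.
Qed.

(** * Subdivision *)

Definition subdiv_edge1 G j (x : R) := ((ep1 (edge_of G j), nv G), x).
Definition subdiv_edge2 G j (x : R) :=
  ((nv G, ep2 (edge_of G j)), elen (edge_of G j) - x).

Lemma edges_split G j : (j < size (edges G))%N ->
  edges G = take j (edges G) ++ edge_of G j :: drop j.+1 (edges G).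
Proof. by move=> hj; rewrite -drop_nth // cat_take_drop. Qed.

Lemma edges_subdiv G j x : (j < size (edges G))%N ->
  edges (subdiv G j x) = take j (edges G) ++ subdiv_edge1 G j x ::
    drop j.+1 (edges G) ++ [:: subdiv_edge2 G j x].
Proof. by move=> hj; rewrite /= set_nthE hj -catA. Qed.

Lemma mem_edges G j e : (j < size (edges G))%N -> e \in edges G ->
  [\/ e \in take j (edges G), e = edge_of G j | e \in drop j.+1 (edges G)].
Proof.
move=> hj; rewrite {1}(edges_split hj) mem_cat inE.
by case/or3P => [?|/eqP|?]; constructor.
Qed.

Lemma mem_edge_of G j : (j < size (edges G))%N -> edge_of G j \in edges G.
Proof. exact: mem_nth. Qed.

Lemma subdiv_well_formed G j x : well_formed G -> (j < size (edges G))%N ->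
  0 < x < elen (edge_of G j) -> well_formed (subdiv G j x).
Proof.
move=> wG hj /andP[x0 xL] e; have [h1 h2 _] := wG _ (mem_edge_of hj).
rewrite edges_subdiv // mem_cat inE mem_cat inE /= => /or4P[|/eqP->||/eqP->] /=;
  rewrite /ep1 /ep2 /elen /=.
- by move=> /mem_take/wG[? ? ?]; split=> //; apply: ltnW.
- by split=> //; apply: ltnW.
- by move=> /mem_drop/wG[? ? ?]; split=> //; apply: ltnW.
- by split=> //; [apply: ltnW|rewrite subr_gt0].
Qed.

(** The two halves force the values at the new vertex and at both ends of the old edge to agree, so
    rigidity of [G] applies. *)
Lemma subdiv_rigid G j x : well_formed G -> rigid G -> (j < size (edges G))%N ->
  rigid (subdiv G j x).
Proof.
move=> wG rG hj f; rewrite edges_subdiv // => fE.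
have E1 : f (ep1 (edge_of G j)) = f (nv G).
  by apply: (fE (subdiv_edge1 G j x)); rewrite mem_cat inE eqxx orbT.
have E2 : f (nv G) = f (ep2 (edge_of G j)).
  by apply: (fE (subdiv_edge2 G j x)); rewrite mem_cat inE mem_cat inE eqxx !orbT.
have /rG cf : forall e, e \in edges G -> f (ep1 e) = f (ep2 e).
  move=> e /(mem_edges hj)[he| -> |he]; last 2 first.
  - by rewrite E1.
  - by apply: fE; rewrite mem_cat inE mem_cat he !orbT.
  - by apply: fE; rewrite mem_cat he.
have [h1 _ _] := wG _ (mem_edge_of hj).
have cm u : (u < (nv G).+1)%N -> f u = f (nv G).
  by rewrite ltnS leq_eqVlt => /orP[/eqP-> //|hu]; rewrite -E1; apply: cf.
by move=> u v hu hv; rewrite cm // [RHS]cm.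
Qed.

Definition interpolate G j (x : R) phi : R :=
  phi (ep1 (edge_of G j)) +
  x / elen (edge_of G j) * (phi (ep2 (edge_of G j)) - phi (ep1 (edge_of G j))).

Definition value_at G phi P : R :=
  match P with Vtx v => phi v | EdgePt j x => interpolate G j x phi end.

Definition extend G P phi (v : nat) : R :=
  match P with
  | Vtx _ => phi v
  | EdgePt j x => if v == nv G then interpolate G j x phi else phi v
  end.

Lemma vertexify_well_formed G P : well_formed G -> valid_point G P ->
  well_formed (vertexify G P).1.
Proof. by case: P => //= j x wG /andP[hj hx]; apply: subdiv_well_formed. Qed.

Lemma vertexify_rigid G P : well_formed G -> rigid G -> valid_point G P ->
  rigid (vertexify G P).1.
Proof. by case: P => //= j x wG rG /andP[hj hx]; apply: subdiv_rigid. Qed.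

Lemma vertexify_ltn G P : valid_point G P ->
  ((vertexify G P).2 < nv (vertexify G P).1)%N.
Proof. by case: P => //=. Qed.

Lemma leq_nv_vertexify G P : (nv G <= nv (vertexify G P).1)%N.
Proof. by case: P => //=. Qed.

Lemma extend_vertex G P phi : extend G P phi (vertexify G P).2 = value_at G phi P.
Proof. by case: P => //= j x; rewrite eqxx. Qed.

Lemma extend_old G P phi v : (v < nv G)%N -> extend G P phi v = phi v.
Proof. by case: P => //= j x hv; rewrite ltn_eqF. Qed.

(* The Dirichlet energy is unchanged because the extension is affine along the
   subdivided edge. *)
Lemma energy_extend G P phi g : well_formed G -> valid_point G P ->
  energy (vertexify G P).1 (extend G P phi) g = energy G phi g.
Proof.
case: P => [v|j x] //= wG /andP[hj /andP[x0 xL]].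
have old e : e \in edges G ->
    dirichlet (extend G (EdgePt j x) phi) g e = dirichlet phi g e.
  by move=> /wG[h1 h2 _]; rewrite /dirichlet !extend_old.
rewrite /energy edges_subdiv // [in RHS](edges_split hj).
rewrite !big_cat !big_cons !big_cat big_seq1 /=.
rewrite [X in X + _ = _]big_seq.
under eq_bigr => e /mem_take he do rewrite (old _ he).
rewrite -big_seq; congr (_ + _).
rewrite [X in _ + (X + _) = _]big_seq.
under eq_bigr => e /mem_drop he do rewrite (old _ he).
rewrite -big_seq addrCA [RHS]addrC; congr (_ + _).
have [h1 h2 L0] := wG _ (mem_edge_of hj).
rewrite /dirichlet /subdiv_edge1 /subdiv_edge2 /ep1 /ep2 /elen /= eqxx.
rewrite !ltn_eqF // /interpolate /ep1 /ep2 /elen.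
rewrite /elen in L0 xL.
field; rewrite ?gt_eqF ?subr_gt0 //.
Qed.

(** An affine function on an edge is affine on each half. The cases place [Q] on another edge,
    before [P], at [P], or beyond it. *)
Lemma value_at_extend G P Q phi : well_formed G -> valid_point G P -> valid_point G Q ->
  value_at (vertexify G P).1 (extend G P phi) (transport G P Q) = value_at G phi Q.
Proof.
case: P => [v|j x] //= wG /andP[hj /andP[x0 xL]].
have [h1 h2 L0] := wG _ (mem_edge_of hj).
case: Q => [v /= hv|j' x' /andP[hj' /andP[x0' xL']]]; first by rewrite ltn_eqF.
have [h1' h2' L0'] := wG _ (mem_edge_of hj').
(* Old edges keep their positions, the first half takes position [j], and the second half is
   appended at the end. *)
have nthE i : (i < size (edges G))%N -> edge_of (subdiv G j x) i =
    if i == j then subdiv_edge1 G j x else edge_of G i.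
  by move=> hi; rewrite /edge_of /= nth_cat size_set_nth (maxn_idPr hj) hi nth_set_nth.
rewrite /lift_point; case: eqP => [E|/eqP E] /=; last first.
  by rewrite /interpolate nthE // (negbTE E) /= !ltn_eqF.
subst j'; case: ltP => [lx|lx] /=.
  rewrite {1}/interpolate nthE // eqxx /subdiv_edge1 /ep1 /ep2 /elen /= eqxx.
  rewrite ltn_eqF // /interpolate /ep1 /ep2 /elen; rewrite /elen in L0.
  by field; rewrite ?gt_eqF.
case: eqP => [->|ne] /=; first by rewrite eqxx.
rewrite {1}/interpolate /edge_of /= nth_cat size_set_nth (maxn_idPr hj) ltnn subnn /=.
rewrite {1 2}/ep1 {1}/ep2 /elen /= eqxx ltn_eqF // /interpolate /elen /ep1 /ep2.
rewrite /elen in L0 xL.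
by field; rewrite ?gt_eqF ?subr_gt0.
Qed.

Lemma transport_valid G P Q : valid_point G P -> valid_point G Q ->
  valid_point (vertexify G P).1 (transport G P Q).
Proof.
case: P => [v|j x] //= /andP[hj /andP[x0 xL]].
case: Q => [v /= hv|j' x' /andP[hj' /andP[x0' xL']]]; first exact: ltnW.
have szE : size (set_nth (edge0 R) (edges G) j (subdiv_edge1 G j x)) = size (edges G).
  by rewrite size_set_nth (maxn_idPr hj).
rewrite /lift_point; case: eqP => [E|/eqP E] /=; last first.
  rewrite size_cat szE /edge_of /= nth_cat szE hj' nth_set_nth /= (negbTE E).
  by rewrite x0' xL' addn1 ltnW.
subst j'; case: ltP => [lx|lx] /=.
  rewrite size_cat szE /edge_of /= nth_cat szE hj' nth_set_nth /= eqxx.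
  by rewrite x0' lx addn1 ltnW.
case: eqP => [_|/eqP ne] //=.
rewrite size_cat szE /edge_of /= nth_cat szE ltnn subnn /= addn1 ltnSn /=.
by rewrite subr_gt0 lt_neqAle eq_sym ne lx /elen /= ltrD2r.
Qed.

Lemma unit_flow_extend G P y z phi : well_formed G -> valid_point G P ->
  unit_flow G y z phi -> unit_flow (vertexify G P).1 y z (extend G P phi).
Proof. by move=> wG hP h g; rewrite energy_extend. Qed.

Lemma jfun_value_at G p q P : well_formed G -> rigid G ->
  (p < nv G)%N -> (q < nv G)%N -> valid_point G P ->
  jfun G (Vtx R p) (Vtx R q) P = value_at G (voltage G q p) P.
Proof.
move=> wG rG hp hq hP; rewrite /jfun /=.
have le := leq_nv_vertexify G P.
have hp' := leq_trans hp le; have hq' := leq_trans hq le.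
(* Reciprocity moves the source from [P] to [q], so a single voltage on [G] serves for every [P]. *)
rewrite jv_sym //; [|exact: vertexify_well_formed|exact: vertexify_rigid|exact: vertexify_ltn].
have V := unit_flow_extend wG hP (voltage_unit_flow wG rG hq hp).
rewrite (jv_unit_flow _ _ hp' _ hq' V); first last.
- exact: vertexify_ltn.
- exact: vertexify_rigid.
- exact: vertexify_well_formed.
by rewrite extend_vertex extend_old // voltage_base // subr0.
Qed.

Lemma resistance_vertexify G P Q (G1 := (vertexify G Q).1)
    (P1 := transport G Q P) (G2 := (vertexify G1 P1).1) :
  resistance G P Q = jv G2 (vertexify G Q).2 (vertexify G1 P1).2 (vertexify G1 P1).2.
Proof.
(* [resistance] lists [P] twice; the second time it is already a vertex and nothing more is
   subdivided. *)
have E : transport G1 P1 P1 = Vtx R (vertexify G1 P1).2.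
  by case: (P1) => //= j x; rewrite eqxx ltxx eqxx.
by rewrite /resistance /jfun /= -/P1 -/G1 E.
Qed.

(** * Deletion and contraction commute with subdivision *)

Definition del_index (k j : nat) : nat := if (j < k)%N then j else j.-1.

Lemma del_index_inj (k i j : nat) : i != k -> j != k ->
  (del_index k i == del_index k j) = (i == j).
Proof. by rewrite /del_index; case: (ltnP i k); case: (ltnP j k) => *; apply/eqP/eqP; lia. Qed.

Lemma del_pointE k j (x : R) : del_point k (EdgePt j x) = EdgePt (del_index k j) x.
Proof. by rewrite /= /del_index; case: ifP. Qed.

Lemma size_remove_nth (T : Type) (s : seq T) k : (k < size s)%N ->
  size (take k s ++ drop k.+1 s) = (size s).-1.
Proof. by move=> hk; rewrite size_cat size_take hk size_drop; lia. Qed.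

Lemma nth_remove_nth (T : Type) (d : T) s k j : (k < size s)%N -> j != k ->
  nth d (take k s ++ drop k.+1 s) (del_index k j) = nth d s j.
Proof.
move=> hk hj; rewrite nth_cat size_take hk /del_index; case: (ltnP j k) => h.
  by rewrite h nth_take.
rewrite ifF; last by apply/negbTE; lia.
by rewrite nth_drop; congr nth; lia.
Qed.

Lemma remove_set_nth (T : Type) (d : T) s k j a :
  (k < size s)%N -> (j < size s)%N -> j != k ->
  take k (set_nth d s j a) ++ drop k.+1 (set_nth d s j a) =
  set_nth d (take k s ++ drop k.+1 s) (del_index k j) a.
Proof.
move=> hk hj jk; have sz : size (set_nth d s j a) = size s.
  by rewrite size_set_nth (maxn_idPr hj).
have hd : (del_index k j < (size s).-1)%N by rewrite /del_index; case: (ltnP j k); lia.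
apply: (@eq_from_nth _ d).
  rewrite size_remove_nth ?sz // size_set_nth size_remove_nth //.
  by rewrite (maxn_idPr hd).
(* [i0] is the position in [s] that ends up at [i] once entry [k] is removed. *)
move=> i _; pose i0 := if (i < k)%N then i else i.+1.
have -> : i = del_index k i0 
  by rewrite /del_index /i0; case: (ltnP i k) => h; [rewrite h|rewrite ifF //; lia].
have ik : i0 != k by rewrite /i0; case: ltnP; lia.
by rewrite nth_set_nth /= !nth_remove_nth ?sz // nth_set_nth /= del_index_inj.
Qed.

Section Delete.
Variables (G : mgraph R) (k : nat).
Hypothesis hk : (k < size (edges G))%N.

Lemma edge_of_delete j : j != k -> edge_of (delete_edge G k) (del_index k j) = edge_of G j.
Proof. exact: nth_remove_nth. Qed.

Lemma del_index_lt j : j != k -> (j < size (edges G))%N ->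
  (del_index k j < size (edges (delete_edge G k)))%N.
Proof. by move=> ? ?; rewrite size_remove_nth // /del_index; case: (ltnP j k); lia. Qed.

Lemma subdiv_delete j x : j != k -> (j < size (edges G))%N ->
  subdiv (delete_edge G k) (del_index k j) x = delete_edge (subdiv G j x) k.
Proof.
move=> jk hj; rewrite /subdiv edge_of_delete // /delete_edge /=; congr MGraph.
rewrite -remove_set_nth // take_cat drop_cat size_set_nth (maxn_idPr hj) hk.
rewrite -catA; congr (_ ++ _); case: ltnP => // h.
(* Here [k] is the last old edge, so only the appended half remains after it. *)
have -> : k.+1 = size (edges G) by apply/eqP; rewrite eqn_leq hk.
by rewrite subnn drop_oversize // size_set_nth (maxn_idPr hj).
Qed.

Lemma in_minus_valid P : in_minus G k P -> valid_point G P.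
Proof. by case/andP. Qed.

Lemma del_point_valid P : in_minus G k P -> valid_point (delete_edge G k) (del_point k P).
Proof.
case: P => [v|j x]; first by case/andP.
rewrite del_pointE => /andP[/= /andP[hj hx] jk].
by rewrite del_index_lt // edge_of_delete.
Qed.

Lemma vertexify_delete P : in_minus G k P ->
  vertexify (delete_edge G k) (del_point k P) =
  (delete_edge (vertexify G P).1 k, (vertexify G P).2).
Proof.
case: P => [v|j x] //; rewrite del_pointE => /andP[/= /andP[hj hx] jk].
by rewrite subdiv_delete.
Qed.

Lemma transport_delete P Q : in_minus G k P -> in_minus G k Q ->
  transport (delete_edge G k) (del_point k P) (del_point k Q) =
  del_point k (transport G P Q).
Proof.
case: P => [v|j x] //; rewrite del_pointE => /andP[/= /andP[hj hx] jk].
case: Q => [v|j' x'] //; rewrite del_pointE => /andP[/= /andP[hj' hx'] jk'].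
rewrite del_index_inj //; case: eqP => [->|_] /=; last by rewrite -del_pointE.
case: ifP => _; first by rewrite del_pointE.
(* Beyond the subdivision point the edge is the appended one, whose index drops by one with the
   deletion. *)
case: ifP => // _; rewrite del_pointE size_remove_nth // /del_index ifF //; lia.
Qed.

Lemma vertexify_edge P : in_minus G k P ->
  edge_of (vertexify G P).1 k = edge_of G k /\ (k < size (edges (vertexify G P).1))%N.
Proof.
case: P => [v|j x] //= => /andP[/= /andP[hj hx] jk].
rewrite /edge_of /= nth_cat size_cat size_set_nth (maxn_idPr hj) hk nth_set_nth /=.
by rewrite eq_sym (negbTE jk) addn1 ltnS ltnW.
Qed.

Lemma transport_in_minus P Q : in_minus G k P -> in_minus G k Q ->
  in_minus (vertexify G P).1 k (transport G P Q).
Proof.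
move=> hP hQ; rewrite /in_minus transport_valid ?in_minus_valid //.
case: P Q hP hQ => [v|j x] [v'|j' x'] //= /andP[_ jk] /andP[_ jk'] //.
case: eqP => //= _; case: ifP => // _; case: ifP => // _; by rewrite gtn_eqF.
Qed.

Lemma delete_well_formed : well_formed G -> well_formed (delete_edge G k).
Proof. by move=> wG e; rewrite mem_cat => /orP[/mem_take|/mem_drop]; apply: wG. Qed.

Lemma energy_delete f g :
  energy G f g = energy (delete_edge G k) f g + dirichlet f g (edge_of G k).
Proof.
by rewrite /energy [in LHS](edges_split hk) !big_cat big_cons /= addrCA addrC.
Qed.

End Delete.

(* Contraction is deletion followed by a relabelling of the vertices; applying
   the relabelling to [nv G], the label of the next subdivision vertex, gives
   the new number of vertices. *)
Definition relabel_edge (h : nat -> nat) e := ((h (ep1 e), h (ep2 e)), elen e).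

Definition relabel_graph (h : nat -> nat) G :=
  MGraph (h (nv G)) (map (relabel_edge h) (edges G)).

Definition relabel_point (h : nat -> nat) P :=
  match P with Vtx v => Vtx R (h v) | EdgePt j x => EdgePt j x end.

Lemma energy_relabel h G f g : energy (relabel_graph h G) f g = energy G (f \o h) (g \o h).
Proof. exact: big_map. Qed.

(** The new vertex [nv G] is sent to [h (nv G)]; the hypothesis on [h] makes the vertex count of the
    subdivision its successor. *)
Lemma vertexify_relabel h G P : h (nv G).+1 = (h (nv G)).+1 -> valid_point G P ->
  vertexify (relabel_graph h G) (relabel_point h P) =
  (relabel_graph h (vertexify G P).1, h (vertexify G P).2).
Proof.
case: P => [v|j x] //= hS /andP[hj hx].
rewrite /relabel_graph /subdiv /edge_of /= hS; congr (MGraph _ _, _).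
rewrite map_cat !set_nthE size_map hj (nth_map (edge0 R)) //.
by rewrite map_cat /= map_take map_drop.
Qed.

Lemma transport_relabel h G P Q :
  transport (relabel_graph h G) (relabel_point h P) (relabel_point h Q) =
  relabel_point h (transport G P Q).
Proof.
by case: P Q => [v|j x] [v'|j' x'] //=; rewrite size_map; do 3 case: ifP => //.
Qed.

(** This depends on [G] only through edge [k], so subdividing off that edge leaves the relabelling
    unchanged. *)
Definition quotient_vertex G k (v : nat) : nat :=
  let e := edge_of G k in if ep1 e == ep2 e then v else relabel (ep1 e) (ep2 e) v.

Lemma relabel_gt a b v : (b < v)%N -> relabel a b v = v.-1.
Proof. by move=> hv; rewrite /relabel gtn_eqF ?hv. Qed.

(** Labels from [nv G] on exceed both end points, so the relabelling shifts them uniformly, as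
    [vertexify_relabel] requires. *)
Lemma quotient_vertex_new G k v : well_formed G -> (k < size (edges G))%N ->
  (nv G <= v)%N -> quotient_vertex G k v.+1 = (quotient_vertex G k v).+1.
Proof.
move=> wG hk hv; have [h1 h2 _] := wG _ (mem_edge_of hk).
rewrite /quotient_vertex; case: ifP => // _; rewrite !relabel_gt //; lia.
Qed.

Lemma contractE G k : well_formed G -> (k < size (edges G))%N ->
  contract G k = relabel_graph (quotient_vertex G k) (delete_edge G k).
Proof.
move=> wG hk; have [h1 h2 _] := wG _ (mem_edge_of hk).
rewrite /contract /relabel_graph /quotient_vertex; case: eqP => E.
  rewrite /delete_edge /=; congr MGraph; rewrite -[LHS]map_id.
  by apply: eq_map => -[[a b] c].
by congr MGraph; rewrite relabel_gt.
Qed.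

Lemma contract_pointE G k P :
  contract_point G k P = relabel_point (quotient_vertex G k) (del_point k P).
Proof.
by rewrite /contract_point /quotient_vertex; case: (del_point k P) => //= v; case: eqP.
Qed.

(** Contraction is deletion followed by relabelling, and both commute with subdivision off edge [k].
    This reduces the contracted side to vertices. *)
Lemma resistance_contract G k P Q : well_formed G -> (k < size (edges G))%N ->
  in_minus G k P -> in_minus G k Q ->
  let G1 := (vertexify G Q).1 in let P1 := transport G Q P in
  let G2 := (vertexify G1 P1).1 in
  let v := quotient_vertex G2 k (vertexify G1 P1).2 in
  resistance (contract G k) (contract_point G k P) (contract_point G k Q) =
  jv (contract G2 k) (quotient_vertex G2 k (vertexify G Q).2) v v.
Proof.
move=> wG hk hP hQ G1 P1 G2 v.
have [e1 hk1] := vertexify_edge hk hQ.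
have hP1 := transport_in_minus hk hQ hP.
have [e2 hk2] := vertexify_edge hk1 hP1.
have w1 := vertexify_well_formed wG (in_minus_valid hQ).
have w2 := vertexify_well_formed w1 (in_minus_valid hP1).
have q2 : quotient_vertex G2 k = quotient_vertex G k by rewrite /quotient_vertex e2 e1.
rewrite contractE // contractE // resistance_vertexify !contract_pointE.
have nvS : quotient_vertex G k (nv (delete_edge G k)).+1 =
    (quotient_vertex G k (nv (delete_edge G k))).+1 by rewrite quotient_vertex_new.
have nvS1 : quotient_vertex G k (nv (delete_edge G1 k)).+1 =
    (quotient_vertex G k (nv (delete_edge G1 k))).+1.
  by rewrite quotient_vertex_new // leq_nv_vertexify.
rewrite !transport_relabel (vertexify_relabel nvS) ?del_point_valid //=.
rewrite transport_delete // vertexify_delete //= (vertexify_relabel nvS1) ?del_point_valid //.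
by rewrite vertexify_delete //= /v q2.
Qed.

(** * Resistances after contracting an edge *)

(** A flow from a vertex to itself has zero energy; this disposes of self-loops. *)
Lemma unit_flow_same G y z phi u v : y = z -> well_formed G -> rigid G ->
  (u < nv G)%N -> (v < nv G)%N -> unit_flow G y z phi -> phi u = phi v.
Proof.
by move=> -> wG rG hu hv F; apply: rG => //; apply: energy_eq0; rewrite // F subrr.
Qed.

Section EdgeContraction.
Variables (G : mgraph R) (k : nat).
Hypotheses (wG : well_formed G) (rG : rigid G) (hk : (k < size (edges G))%N).
Let p := ep1 (edge_of G k).
Let q := ep2 (edge_of G k).
Let L := elen (edge_of G k).
Let H := delete_edge G k.
Let C := contract G k.
Let quot := quotient_vertex G k.

Let hp : (p < nv G)%N. Proof. by have [] := wG (mem_edge_of hk). Qed.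
Let hq : (q < nv G)%N. Proof. by have [] := wG (mem_edge_of hk). Qed.
Let L0 : 0 < L. Proof. by have [] := wG (mem_edge_of hk). Qed.
Let wH : well_formed H. Proof. exact: delete_well_formed. Qed.

(** A section of [quot]; when [p] and [q] differ it skips [q], so the merged vertex is represented
    by [p]. *)
Let lift_vertex (i : nat) : nat :=
  if p == q then i else if (q <= i)%N then i.+1 else i.

Let quotK i : quot (lift_vertex i) = i.
Proof.
rewrite /quot /lift_vertex /quotient_vertex -/p -/q; case: eqP => // pq.
rewrite /relabel; case: (leqP q i) => h; last by rewrite ltn_eqF // ltnNge ltnW.
by rewrite gtn_eqF ?ltnS // h.
Qed.

Let lift_vertexK w v : w p = w q -> w (lift_vertex (quot v)) = w v :> R.
Proof.
move=> wpq; rewrite /quot /lift_vertex /quotient_vertex -/p -/q; case: eqP => // pq.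
rewrite /relabel; case: (eqVneq v q) => [->|vq].
  case: (ltnP q p) => h; first by rewrite ifT ?prednK //; lia.
  by rewrite ifF //; lia.
case: (ltnP q v) => h; first by rewrite ifT ?prednK //; lia.
by rewrite ifF //; lia.
Qed.

Let quot_pq : quot p = quot q.
Proof.
rewrite /quot /quotient_vertex -/p -/q; case: (eqVneq p q) => // pq.
by rewrite /relabel eqxx (negbTE pq).
Qed.

Let quot_lt v : (v < nv G)%N -> (quot v < nv C)%N.
Proof.
move=> hv; rewrite /C contractE //= /quot /quotient_vertex -/p -/q; case: eqP => // pq.
rewrite (relabel_gt _ hq) /relabel; 
case: (eqVneq v q) => vq; [case: (ltnP q p) | case: (ltnP q v)]; lia.
Qed.

Let lift_vertex_lt i : (i < nv C)%N -> (lift_vertex i < nv G)%N.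
Proof.
rewrite /C contractE //= /lift_vertex /quot /quotient_vertex -/p -/q; case: eqP => // pq.
rewrite (relabel_gt _ hq); case: (leqP q i); lia.
Qed.

Let contract_well_formed : well_formed C.
Proof.
move=> e; rewrite {1}/C contractE // => /mapP[e0 /wH[h1 h2 h3] ->].
by split=> //; apply: quot_lt.
Qed.

(** Pull [f] back along [quot]: the condition on edge [k] holds because [quot] merges its ends. *)
Let contract_rigid : rigid C.
Proof.
move=> f; rewrite {1}/C contractE // => fE u v hu hv.
rewrite -(quotK u) -(quotK v); apply: (rG (f := f \o quot)); try exact: lift_vertex_lt.
move=> e /(mem_edges hk)[he| -> |he] /=; last 2 first.
- by rewrite -/p -/q quot_pq.
- by apply: (fE (relabel_edge quot e)); apply: map_f; rewrite mem_cat he orbT.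
- by apply: (fE (relabel_edge quot e)); apply: map_f; rewrite mem_cat he.
Qed.

(** Functions on the contraction are those on [H] that agree at [p] and [q], so Kirchhoff's law is
    tested only on such [g]. *)
Let jv_contract z x y w : (z < nv G)%N -> (x < nv G)%N -> (y < nv G)%N ->
  w p = w q -> (forall g, g p = g q -> energy H w g = g y - g z) ->
  jv C (quot z) (quot x) (quot y) = w x - w z.
Proof.
move=> hz hx hy wpq wE.
rewrite (jv_unit_flow (phi := w \o lift_vertex)) ?quot_lt //= ?lift_vertexK //.
move=> g; rewrite /C contractE // energy_relabel -/quot.
rewrite (energy_ext (f' := w) (g' := g \o quot)) //.
  by rewrite wE //= quot_pq.
by move=> v _ /=; rewrite lift_vertexK.
Qed.

Variables (s t : nat).
Hypotheses (hs : (s < nv G)%N) (ht : (t < nv G)%N).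

(** A self-loop carries no current, so one potential solves both problems. *)
Lemma contract_loop_resistance : p = q ->
  jv G t s s = jv C (quot t) (quot s) (quot s).
Proof.
move=> pq; have U := voltage_unit_flow wG rG hs ht.
rewrite (jv_unit_flow _ _ _ _ _ U) //.
rewrite (jv_contract (w := voltage G s t)) ?pq // => g _.
by rewrite -U (energy_delete hk) /dirichlet -/p -/q pq subrr mul0r mul0r addr0.
Qed.

(* Adding a multiple of the flow psi through the deleted edge's end points to
   the H-voltage u from s to t gives both the G-voltage (the multiple is fixed
   by Ohm's law on the edge) and the voltage on the contraction (the multiple
   is fixed by equal potentials at p and q). *)
Lemma contract_nonbridge_resistance psi (Ri := psi q - psi p) : rigid H -> p != q ->
  unit_flow H q p psi ->
  [/\ 0 < Ri,
      jv G t s s = jv C (quot t) (quot s) (quot s) +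
        L / (Ri * (L + Ri)) * (psi s - psi t) ^+ 2
    & forall phi, unit_flow G q p phi ->
        phi s - phi t = L / (L + Ri) * (psi s - psi t)].
Proof.
move=> rH pq psiE.
(* [Ri] is the energy of [psi]. Were it zero, [psi] would pair to zero with everything, yet testing
   on [delta q] gives 1. *)
have Ri0 : 0 < Ri.
  rewrite lt_def /Ri -psiE energy_ge0 // andbT; apply/eqP => /energy_eq0.
  move=> /(_ wH) psic; have := psiE (delta q).
  rewrite /energy big_seq big1 => [|e he]; last first.
    by rewrite /dirichlet psic // subrr !mul0r.
  by rewrite /delta eqxx (negbTE pq) subr0 => /esym/eqP; rewrite oner_eq0.
have LR0 : 0 < L + Ri by rewrite addr_gt0.
pose u := voltage H s t; have uE : unit_flow H s t u by apply: voltage_unit_flow.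
have Du : u q - u p = psi s - psi t by rewrite -psiE energyC uE.
set D := psi s - psi t in Du *.
split=> //.
  rewrite (jv_unit_flow (phi := fun v => u v + (- D / (L + Ri)) * psi v)) //; last first.
    move=> g; rewrite (energy_delete hk) energy_linear uE psiE /dirichlet -/p -/q -/L.
    have -> : u p = u q - D by rewrite -Du; ring.
    have -> : psi q = psi p + Ri by rewrite /Ri; ring.
    by field; rewrite !gt_eqF.
  rewrite (jv_contract (w := fun v => u v + (- D / Ri) * psi v)) //; first last.
  - by move=> g gpq; rewrite energy_linear uE psiE gpq subrr mulr0 addr0.
  - have -> : u p = u q - D by rewrite -Du; ring.
    have -> : psi q = psi p + Ri by rewrite /Ri; ring.
    by field; rewrite gt_eqF.
  have -> : psi s = psi t + D by rewrite /D; ring.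
  by field; rewrite !gt_eqF.
move=> phi phiE.
(* Current division: [H] and the edge are in parallel between [q] and [p], and [H] carries the share
   [L / (L + Ri)]. *)
have psiG : unit_flow G q p (fun v => 0 + L / (L + Ri) * psi v).
  move=> g; rewrite (energy_delete hk) energy_linear psiE /dirichlet -/p -/q -/L.
  have -> : psi q = psi p + Ri by rewrite /Ri; ring.
  rewrite /energy big1 => [|e _]; last by rewrite /dirichlet subrr !mul0r.
  by field; rewrite !gt_eqF.
have := jv_unit_flow wG rG hp hs hq phiE; rewrite (jv_unit_flow _ _ _ _ _ psiG) // => Es.
have := jv_unit_flow wG rG hp ht hq phiE; rewrite (jv_unit_flow _ _ _ _ _ psiG) // => Et.
have -> : phi s - phi t = (phi s - phi p) - (phi t - phi p) by ring.
by rewrite -Es -Et /D; ring.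
Qed.

(** Adding a multiple of [chi] changes no energy on [H], so the drop across the edge can be
    cancelled to obtain the voltage on the contraction. *)
Lemma contract_bridge_resistance chi :
  (forall g, energy H chi g = 0) -> chi q - chi p = 1 ->
  jv G t s s = jv C (quot t) (quot s) (quot s) + L * (chi s - chi t) ^+ 2.
Proof.
move=> chiE chi1; have U := voltage_unit_flow wG rG hs ht.
set u := voltage G s t in U; pose c := u q - u p.
(* Test the law for [u] against [chi]: only edge [k] contributes, namely [c / L]. *)
have cE : c = L * (chi s - chi t).
  rewrite -U (energy_delete hk) energyC chiE /dirichlet -/p -/q -/L.
  have -> : chi q = chi p + 1 by rewrite -chi1; ring.
  by rewrite /c; field; rewrite gt_eqF.
rewrite (jv_unit_flow _ _ _ _ _ U) // (jv_contract (w := fun v => u v + (- c) * chi v)) //.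
- by rewrite cE; ring.
- have -> : chi q = chi p + 1 by rewrite -chi1; ring.
  by rewrite /c; ring.
- move=> g gpq; rewrite energy_linear chiE mulr0 addr0 -U (energy_delete hk).
  by rewrite /dirichlet -/p -/q gpq subrr mulr0 mul0r addr0.
Qed.

End EdgeContraction.

(** * Components left by the removal of a bridge *)

Section BridgeComponents.
Variables (G : mgraph R) (k : nat).
Hypotheses (wG : well_formed G) (cG : connected G) (hk : (k < size (edges G))%N).
Let p := ep1 (edge_of G k).
Let q := ep2 (edge_of G k).
Let H := delete_edge G k.

Lemma adj_sym G' u v : adj G' u v = adj G' v u.
Proof. by apply: eq_has => e; rewrite orbC. Qed.

Lemma reach_sym G' u v : reach G' u v -> reach G' v u.
Proof.
elim=> [a b|a|a b c _ h _ h']; last exact: rt_trans h' h.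
  by rewrite adj_sym; apply: rt_step.
exact: rt_refl.
Qed.

(** Follow a path in [G] from [p]: a step missing in [H] uses edge [k] and so lands on [p] or
    [q]. *)
Lemma delete_edge_cover v : (v < nv G)%N -> reach H p v \/ reach H q v.
Proof.
have [hp hq _] := wG (mem_edge_of hk).
move=> hv; suff step a b : reach G a b -> reach H p a \/ reach H q a ->
    reach H p b \/ reach H q b.
  by apply: step (cG hp hv) _; left; apply: rt_refl.
elim=> {a b} // [a b ab|a b c _ h _ h' /h /h' //].
have [ab'|] := boolP (adj H a b).
  by case=> h; [left|right]; apply: rt_trans h (rt_step _ _ _ _ ab').
case/hasP: ab => e /(mem_edges hk)[he| -> |he] ee /negP nab; last 2 first.
- case/orP: ee => /andP[/eqP <- /eqP <-] _; first by right; apply: rt_refl.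
  by left; apply: rt_refl.
- by case: nab; apply/hasP; exists e; rewrite // mem_cat he orbT.
- by case: nab; apply/hasP; exists e; rewrite // mem_cat he.
Qed.

Lemma bridge_ends_separated : is_bridge G k -> ~ reach H p q.
Proof.
move=> nc pq; apply: nc => u v hu hv.
have fromp w : (w < nv G)%N -> reach H p w.
  by move/delete_edge_cover => [//|h]; apply: rt_trans pq h.
exact: rt_trans (reach_sym (fromp u hu)) (fromp v hv).
Qed.

Definition component_indicator (v : nat) : R :=
  if excluded_middle_informative (reach H q v) then 1 else 0.

Lemma component_indicator_reach u v : reach H u v ->
  component_indicator u = component_indicator v.
Proof.
move=> uv; rewrite /component_indicator.
case: excluded_middle_informative => h; case: excluded_middle_informative => h' //.
  by case: h'; apply: rt_trans h uv.
by case: h; apply: rt_trans h' (reach_sym uv).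
Qed.

Lemma component_indicator_edge e : e \in edges H ->
  component_indicator (ep1 e) = component_indicator (ep2 e).
Proof.
move=> he; apply/component_indicator_reach/rt_step/hasP.
by exists e; rewrite ?eqxx.
Qed.

Lemma component_indicator_ends : is_bridge G k ->
  component_indicator q - component_indicator p = 1.
Proof.
move=> b; rewrite /component_indicator.
case: excluded_middle_informative => h; last by case: h; apply: rt_refl.
case: excluded_middle_informative => h'; last by rewrite subr0.
by case: (bridge_ends_separated b); apply: reach_sym.
Qed.

(** There are at most two components: vertices both outside that of [q] are joined through [p]. *)
Lemma component_indicator_sqr u v : (u < nv G)%N -> (v < nv G)%N -> ~ reach H u v ->
  (component_indicator u - component_indicator v) ^+ 2 = 1.
Proof.
move=> hu hv nuv; rewrite /component_indicator.
case: excluded_middle_informative => h; case: excluded_middle_informative => h'.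
- by case: nuv; apply: rt_trans (reach_sym h) h'.
- by rewrite subr0 expr1n.
- by rewrite sub0r sqrrN expr1n.
case: nuv; case: (delete_edge_cover hu) => // hu'; case: (delete_edge_cover hv) => // hv'.
exact: rt_trans (reach_sym hu') hv'.
Qed.

Lemma value_at_component P : valid_point H P ->
  value_at H component_indicator P = component_indicator (anchor H P).
Proof.
case: P => //= j x /andP[hj _]; rewrite /interpolate.
by rewrite (component_indicator_edge (@mem_edge_of H j hj)) subrr mulr0 addr0.
Qed.

Lemma energy_component g : energy H component_indicator g = 0.
Proof.
rewrite /energy big_seq big1 // => e he.
by rewrite /dirichlet component_indicator_edge // subrr !mul0r.
Qed.

End BridgeComponents.

(** * Subdivision at two points, the sink [Q] before the source [P] as in [resistance] *)

Definition vertexify2 G P Q : mgraph R * nat :=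
  vertexify (vertexify G Q).1 (transport G Q P).

Definition extend2 G P Q phi : nat -> R :=
  extend (vertexify G Q).1 (transport G Q P) (extend G Q phi).

Section Vertexify2.
Variables (G : mgraph R) (P Q : point R).
Hypotheses (wG : well_formed G) (hP : valid_point G P) (hQ : valid_point G Q).

Let hP' : valid_point (vertexify G Q).1 (transport G Q P).
Proof. exact: transport_valid. Qed.
Let wG' : well_formed (vertexify G Q).1.
Proof. exact: vertexify_well_formed. Qed.

Lemma vertexify2_well_formed : well_formed (vertexify2 G P Q).1.
Proof. exact: vertexify_well_formed. Qed.

Lemma vertexify2_rigid : rigid G -> rigid (vertexify2 G P Q).1.
Proof. by move=> rG; apply: vertexify_rigid => //; apply: vertexify_rigid. Qed.

Lemma vertexify2_left_lt : ((vertexify2 G P Q).2 < nv (vertexify2 G P Q).1)%N.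
Proof. exact: vertexify_ltn. Qed.

Lemma vertexify2_right_lt : ((vertexify G Q).2 < nv (vertexify2 G P Q).1)%N.
Proof. exact: leq_trans (vertexify_ltn hQ) (leq_nv_vertexify _ _). Qed.

Lemma extend2_left phi : extend2 G P Q phi (vertexify2 G P Q).2 = value_at G phi P.
Proof. by rewrite /extend2 extend_vertex value_at_extend. Qed.

Lemma extend2_right phi : extend2 G P Q phi (vertexify G Q).2 = value_at G phi Q.
Proof. by rewrite /extend2 extend_old ?extend_vertex // vertexify_ltn. Qed.

Lemma extend2_old phi v : (v < nv G)%N -> extend2 G P Q phi v = phi v.
Proof.
move=> hv; rewrite /extend2 extend_old ?extend_old //.
exact: leq_trans hv (leq_nv_vertexify _ _).
Qed.

Lemma energy_extend2 phi g :
  energy (vertexify2 G P Q).1 (extend2 G P Q phi) g = energy G phi g.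
Proof. by rewrite energy_extend // energy_extend. Qed.

End Vertexify2.

Lemma vertexify2_edge G k P Q : (k < size (edges G))%N ->
  in_minus G k P -> in_minus G k Q ->
  edge_of (vertexify2 G P Q).1 k = edge_of G k /\
  (k < size (edges (vertexify2 G P Q).1))%N.
Proof.
move=> hk hP hQ; have [<- hk'] := vertexify_edge hk hQ.
exact: vertexify_edge (transport_in_minus hk hQ hP).
Qed.

Lemma vertexify2_delete G k P Q : (k < size (edges G))%N ->
  in_minus G k P -> in_minus G k Q ->
  vertexify2 (delete_edge G k) (del_point k P) (del_point k Q) =
  (delete_edge (vertexify2 G P Q).1 k, (vertexify2 G P Q).2).
Proof.
move=> hk hP hQ; have [_ hk'] := vertexify_edge hk hQ.
rewrite /vertexify2 transport_delete // vertexify_delete //= vertexify_delete //.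
exact: transport_in_minus.
Qed.

End Resistance.

(** * Transfer from vertices to arbitrary points *)

Theorem theorem3p3 (R : realType) (G : mgraph R) (k : nat) :
  metrized_graph G -> (k < size (edges G))%N ->
  let e := edge_of G k in
  let p := ep1 e in let q := ep2 e in let L := elen e in
  let Gm := delete_edge G k in
  let Gc := contract G k in
  (~ is_bridge G k ->
     let Ri := resistance Gm (Vtx R p) (Vtx R q) in
     forall s t : point R, in_minus G k s -> in_minus G k t ->
       let rst := resistance G s t in
       let rc := resistance Gc (contract_point G k s) (contract_point G k t) in
       let js := jfun G (Vtx R p) (Vtx R q) s in
       let jt := jfun G (Vtx R p) (Vtx R q) t in
       [/\ rst = rc + (L + Ri) / (L * Ri) * (js - jt) ^+ 2,
           rst = rc + L / (Ri * (L + Ri)) *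
                 (jfun Gm (Vtx R p) (Vtx R q) (del_point k s)
                  - jfun Gm (Vtx R p) (Vtx R q) (del_point k t)) ^+ 2,
           rc <= rst
         & (rst = rc <-> js = jt)]) /\
  (is_bridge G k ->
     forall s t : point R, in_minus G k s -> in_minus G k t ->
       let rst := resistance G s t in
       let rc := resistance Gc (contract_point G k s) (contract_point G k t) in
       (same_component Gm (del_point k s) (del_point k t) -> rst = rc) /\
       (~ same_component Gm (del_point k s) (del_point k t) -> rst = rc + L)).
Proof.
move=> [_ [wG cG]] hk e p q L Gm Gc; rewrite -/(well_formed G) in wG.
have rG := connected_rigid cG.
have [hp hq L0] : [/\ (p < nv G)%N, (q < nv G)%N & 0 < L] by apply: wG (mem_edge_of hk).
have wH : well_formed Gm := delete_well_formed (k := k) wG.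
have common s t : in_minus G k s -> in_minus G k t ->
    let G2 := (vertexify2 G s t).1 in
    [/\ well_formed G2, rigid G2, (k < size (edges G2))%N,
        ((vertexify2 G s t).2 < nv G2)%N /\ ((vertexify G t).2 < nv G2)%N
      & edge_of G2 k = edge_of G k].
  move=> hs ht /=; have [vs vt] := (in_minus_valid hs, in_minus_valid ht).
  have [e2 hk2] := vertexify2_edge hk hs ht.
  split=> //; first exact: vertexify2_well_formed.
  - exact: vertexify2_rigid.
  - by split; [apply: vertexify2_left_lt | apply: vertexify2_right_lt].
split=> [nb Ri s t hs ht | br s t hs ht] rst rc.
(* Not being a bridge is a double negation of connectedness, hence the classical step. *)
- move=> js jt; have rH : rigid Gm by apply: connected_rigid; apply: NNPP.
  have [vs vt] := (in_minus_valid hs, in_minus_valid ht).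
  have [w2 r2 hk2 [lt_a lt_b] e2] := common s t hs ht.
  have [us ut] := (del_point_valid hk hs, del_point_valid hk ht).
  have psiE := voltage_unit_flow wH rH hq hp.
  have phiE := voltage_unit_flow wG rG hq hp.
  have RiE : Ri = voltage Gm q p q - voltage Gm q p p.
    (* [Ri] is measured with current from [p] to [q], the voltage here with current from [q] to [p],
       hence the sign. *)
    have psiN : unit_flow Gm p q (fun v => 0 + (-1) * voltage Gm q p v).
      move=> g; rewrite energy_linear psiE /energy big1 => [|f _]; first by ring.
      by rewrite /dirichlet subrr !mul0r.
    by rewrite /Ri /resistance /jfun /= (jv_unit_flow _ _ _ _ _ psiN) //; ring.
  rewrite !(jfun_value_at wH rH) //.
  have jsE : js = value_at G (voltage G q p) s by apply: jfun_value_at.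
  have jtE : jt = value_at G (voltage G q p) t by apply: jfun_value_at.
  move: jsE jtE; rewrite -(extend2_left wG vs vt) -(extend2_right s vt) => jsE jtE.
  have phi2 : unit_flow (vertexify2 G s t).1 q p (extend2 G s t (voltage G q p)).
    by move=> g; rewrite energy_extend2.
  set G2 := (vertexify2 G s t).1 in w2 r2 hk2 lt_a lt_b e2 phi2.
  have [eH2 bH] : vertexify2 Gm (del_point k s) (del_point k t) =
      (delete_edge G2 k, (vertexify2 G s t).2) /\
      (vertexify Gm (del_point k t)).2 = (vertexify G t).2.
    by rewrite vertexify2_delete // vertexify_delete.
  rewrite -(extend2_left wH us ut) -(extend2_right (del_point k s) ut) eH2 bH /=.
  set psi := extend2 _ _ _ _.
  have psi2 : unit_flow (delete_edge G2 k) q p psi.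
    by move=> g; have := energy_extend2 wH us ut (voltage Gm q p) g; rewrite eH2 psiE.
  have rH2 : rigid (delete_edge G2 k).
    by have := vertexify2_rigid wH us ut rH; rewrite eH2.
  have -> : rst = jv G2 (vertexify G t).2 (vertexify2 G s t).2 (vertexify2 G s t).2.
    exact: resistance_vertexify.
  have -> : rc = _ := resistance_contract wG hk hs ht.
  rewrite -/(vertexify2 G s t) -/G2 jsE jtE.
  (* For a self-loop both potentials are constant, so each squared difference is zero whatever its
     coefficient, division by zero included. *)
  have [pq|pq] := eqVneq p q.
    rewrite -(contract_loop_resistance w2 r2 hk2 lt_a lt_b) ?e2 //.
    rewrite (unit_flow_same (esym pq) w2 r2 lt_a lt_b phi2).
    rewrite (unit_flow_same (esym pq) (delete_well_formed w2) rH2 lt_a lt_b psi2).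
    by rewrite !subrr expr0n !mulr0 !addr0.
  have psiRi : psi q - psi p = Ri by rewrite RiE /psi !extend2_old.
  have := contract_nonbridge_resistance w2 r2 hk2 lt_a lt_b (psi := psi) rH2.
  rewrite e2 -/e -/p -/q -/L psiRi => /(_ pq psi2)[Ri0 -> /(_ _ phi2) Dphi].
  rewrite Dphi; set D := psi _ - psi _ in Dphi *.
  have LR0 : 0 < L + Ri by rewrite addr_gt0.
  split=> //.
  (* The two correction terms agree because [Dphi] scales [D] by [L / (L + Ri)]. *)
  + by field; rewrite !gt_eqF.
  + by rewrite lerDl mulr_ge0 ?sqr_ge0 ?divr_ge0 ?mulr_ge0 // ltW.
  (* Both coefficients are nonzero, so each side of the equivalence says that [D] vanishes. *)
  + have c0 : L / (L + Ri) != 0 by rewrite mulf_neq0 ?invr_neq0 ?gt_eqF.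
    have c0' : L / (Ri * (L + Ri)) != 0.
      by rewrite mulf_neq0 ?invr_neq0 ?mulf_neq0 ?gt_eqF.
    split=> [/eqP|/eqP]; last first.
      rewrite -subr_eq0 Dphi mulf_eq0 (negbTE c0) => /eqP ->.
      by rewrite expr0n mulr0 addr0.
    rewrite -subr_eq0 addrAC subrr add0r mulf_eq0 (negbTE c0') sqrf_eq0 => /eqP D0.
    by apply/eqP; rewrite -subr_eq0 Dphi D0 mulr0.
have [w2 r2 hk2 [lt_a lt_b] e2] := common s t hs ht.
have [vs vt] := (in_minus_valid hs, in_minus_valid ht).
have [us ut] := (del_point_valid hk hs, del_point_valid hk ht).
set G2 := (vertexify2 G s t).1 in w2 r2 hk2 lt_a lt_b e2.
have [eH2 bH] : vertexify2 Gm (del_point k s) (del_point k t) =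
    (delete_edge G2 k, (vertexify2 G s t).2) /\
    (vertexify Gm (del_point k t)).2 = (vertexify G t).2.
  by rewrite vertexify2_delete // vertexify_delete.
pose ind := component_indicator G k.
pose chi := extend2 Gm (del_point k s) (del_point k t) ind.
have chiE g : energy (delete_edge G2 k) chi g = 0.
  by have := energy_extend2 wH us ut ind g; rewrite eH2 energy_component.
have chi1 : chi q - chi p = 1.
  by rewrite /chi !extend2_old //; apply: component_indicator_ends.
(* One formula covers both alternatives: the square is 0 within a component and 1 across the
   bridge. *)
have rstE : rst = rc + L * (ind (anchor Gm (del_point k s)) -
    ind (anchor Gm (del_point k t))) ^+ 2.
  have -> : rst = jv G2 (vertexify G t).2 (vertexify2 G s t).2 (vertexify2 G s t).2.
    exact: resistance_vertexify.
  have -> : rc = _ := resistance_contract wG hk hs ht.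
  rewrite -/(vertexify2 G s t) -/G2.
  rewrite (contract_bridge_resistance w2 r2 hk2 lt_a lt_b chiE) e2 //.
  have := extend2_left wH us ut ind; rewrite eH2 -/chi /= => ->.
  have := extend2_right (del_point k s) ut ind; rewrite bH -/chi /= => ->.
  by rewrite !value_at_component.
rewrite rstE; split=> [/component_indicator_reach E|sep].
  by rewrite /ind E subrr expr0n mulr0 addr0.
have anchor_lt P : valid_point Gm P -> (anchor Gm P < nv G)%N.
  by case: P => // j x /andP[hj _]; have [] := wH _ (@mem_edge_of R Gm j hj).
by rewrite component_indicator_sqr ?mulr1 //; apply: anchor_lt.
Qed.
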